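(* Let $\alpha$ be a curve immersed in the hyperbolic space $\mathbb{H}^{3}$ and let $N$ be a unit normal vector field along $\alpha$. The ruled surface $f(s,\lambda)=\gamma_{N(s)}(\lambda)$ defined by $N$ along $\alpha$ is developable if and only if $N$ is an RM vector field along $\alpha$.
   Context: $\mathbb{H}^3$ is the complete, simply connected 3-dimensional Riemannian manifold of constant sectional curvature $-1$, with metric $g$ and Levi-Civita connection $\nabla$. Curves and vector fields are smooth. Hyperbolic lines are the geodesics of $\mathbb{H}^3$; hyperbolic planes are the totally geodesic complete 2-dimensional submanifolds. For a tangent vector $v$ at $p\in\mathbb{H}^3$, $\gamma_v$ denotes the geodesic with $\gamma_v(0)=p$, $\gamma_v'(0)=v$; thus $\gamma_{N(s)}(0)=\alpha(s)$ and $\gamma_{N(s)}'(0)=N(s)$. A ruled surface is defined by a smooth family of hyperbolic lines touching a curve, called its directrix; here it is parametrized as $f(s,\lambda)=\gamma_{N(s)}(\lambda)$, with directrix $\alpha$ and unit vector field $N$ along $\alpha$. The tangent plane of a surface $S$ at a point $p$ is the hyperbolic plane tangent to $S$ at $p$, i.e. $\exp_p(T_pS)$. A ruled surface is developable if its tangent plane at a point coincides with the tangent plane at any (regular) point of the same line of the ruling. A normal vector field $N$ along $\alpha$ is called a rotation minimizing (RM) vector field if it is parallel with respect to the normal connection of $\alpha$; equivalently, $\nabla_{\alpha'}N$ is proportional to $\alpha'$. *)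

(* Defs.v *)
From mathcomp Require Import all_boot all_order all_algebra.
From mathcomp Require Import all_classical all_reals all_analysis.

Set Implicit Arguments.
Unset Strict Implicit.
Unset Printing Implicit Defensive.

Import Order.TTheory GRing.Theory Num.Theory.
Import numFieldNormedType.Exports.

Local Open Scope classical_set_scope.
Local Open Scope ring_scope.

Section Hyperbolic3.
Variable R : realType.

Notation E := 'rV[R]_4.

Implicit Types (I : set R) (p u v w : E) (c X alpha N : R -> E).
Implicit Types (f : R -> R -> E).

(* Hyperbolic 3-space is the upper sheet of the two-sheeted hyperboloid in
   Minkowski space R^{1,3}.  Its metric g is the restriction of [lor] to the
   tangent spaces, and its Levi-Civita connection is the lor-orthogonal
   projection of the ambient derivative. *)
Definition lor u v : R :=
  - (u 0 0 * v 0 0) + \sum_(i < 3) u 0 (lift 0 i) * v 0 (lift 0 i).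

Definition H3 : set E := [set p | lor p p = -1 /\ 0 < p 0 0].

Definition tangent p v : Prop := lor p v = 0.

(* The sign is + because lor p p = -1 on [H3]. *)
Definition tan_proj p w : E := w + lor p w *: p.

Definition smooth_on I c : Prop :=
  forall (n : nat) s, I s -> derivable (derive1n n c) s 1.

(* The covariant derivative along the curve c of the vector field X. *)
Definition cov_deriv c X (s : R) : E := tan_proj (c s) (derive1 X s).

Definition is_geodesic c : Prop :=
  [/\ smooth_on setT c,
      forall t, H3 (c t) &
      forall t, cov_deriv c (derive1 c) t = 0].

(* gamma_v: the set below is a singleton when p is in [H3] and v is tangent at
   p; [geod p v] is a junk value otherwise. *)
Definition geod p v : R -> E :=
  get [set c | [/\ is_geodesic c, c 0 = p & derive1 c 0 = v]].

(* The exponential map of H3 at p. *)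
Definition hexp p v : E := geod p v 1.

Definition immersed_curve I alpha : Prop :=
  [/\ smooth_on I alpha,
      forall s, I s -> H3 (alpha s) &
      forall s, I s -> derive1 alpha s != 0].

Definition unit_normal_field I alpha N : Prop :=
  smooth_on I N /\
  forall s, I s ->
    [/\ tangent (alpha s) (N s),
        lor (N s) (derive1 alpha s) = 0 &
        lor (N s) (N s) = 1].

(* The normal connection of alpha: the component of the covariant derivative
   orthogonal to alpha'. *)
Definition normal_deriv alpha X (s : R) : E :=
  let T := derive1 alpha s in
  let D := cov_deriv alpha X s in
  D - (lor D T / lor T T) *: T.

Definition RM_field I alpha N : Prop :=
  forall s, I s -> normal_deriv alpha N s = 0.

Definition ruled_surface alpha N (s l : R) : E := geod (alpha s) (N s) l.

(* The two rows are the partial derivatives of f at (s, l). *)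
Definition partials f (s l : R) : 'M[R]_(1 + 1, 4) :=
  col_mx (derive1 (f^~ l) s) (derive1 (f s) l).

Definition regular_at f (s l : R) : Prop := row_free (partials f s l).

Definition tangent_space f (s l : R) : set E :=
  [set v | (v <= partials f s l)%MS].

Definition tangent_plane f (s l : R) : set E :=
  hexp (f s l) @` tangent_space f s l.

(* Tangent planes exist only at regular points, so both points are regular:
   s ranges over I and l over the whole line; the curves f s are the lines of
   the ruling. *)
Definition developable I f : Prop :=
  forall s, I s -> forall l1 l2 : R,
    regular_at f s l1 -> regular_at f s l2 ->
    tangent_plane f s l1 = tangent_plane f s l2.

End Hyperbolic3.

(* Main.v *)
Require Import Defs.
From mathcomp Require Import all_boot all_order all_algebra.
From mathcomp Require Import all_classical all_reals all_analysis.
From mathcomp Require Import ring lra.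
Import Order.TTheory GRing.Theory Num.Theory.
Import numFieldNormedType.Exports.
Local Open Scope classical_set_scope.
Local Open Scope ring_scope.

(* In the hyperboloid model a geodesic satisfies c'' = <c', c'> c with constant
   speed r, hence c t = cosh (r t) p + sinh (r t) u.  The image of a subspace V of
   tangent vectors at p under exp_p is therefore the trace on H3 of the linear
   span of p and V.  For the ruled surface f s l = cosh l alpha + sinh l N this
   identifies the tangent plane at a regular point with the trace of
   span (alpha, N, X_l), where X_l = cosh l alpha' + sinh l N'.  Differentiating
   the orthogonality relations shows that N', like alpha', is orthogonal to alpha
   and N.  So N is RM iff N' is a multiple of alpha', in which case X_l is one too
   and the plane does not depend on l; conversely, if the planes at l = 0 and
   l = 1 agree, alpha' is parallel to X_1, hence N' is parallel to alpha'. *)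

(** * The Lorentz form: its signs on [H3] and on tangent vectors *)

Section Minkowski.
Context {R : realType}.
Implicit Types (p q u v w : 'rV[R]_4) (a : R).

Lemma lorE u v : lor u v =
  - (u 0 0 * v 0 0) + (u 0 1 * v 0 1 + u 0 2 * v 0 2 + u 0 3 * v 0 3).
Proof.
rewrite /lor !big_ord_recl big_ord0 addr0 !addrA.
by congr (_ + u 0 _ * v 0 _ + u 0 _ * v 0 _ + u 0 _ * v 0 _); apply/val_inj.
Qed.

Lemma lorC u v : lor u v = lor v u.
Proof. by rewrite !lorE; ring. Qed.

Lemma lorDl u v w : lor (u + v) w = lor u w + lor v w.
Proof. by rewrite !lorE !mxE; ring. Qed.

Lemma lorZl a u w : lor (a *: u) w = a * lor u w.
Proof. by rewrite !lorE !mxE; ring. Qed.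

Lemma lorDr u v w : lor w (u + v) = lor w u + lor w v.
Proof. by rewrite !(lorC w) lorDl. Qed.

Lemma lorZr a u w : lor w (a *: u) = a * lor w u.
Proof. by rewrite !(lorC w) lorZl. Qed.

Lemma lor0l u : lor 0 u = 0.
Proof. by rewrite -(scale0r 0) lorZl mul0r. Qed.

Definition lor_lin := (lorDl, lorDr, lorZl, lorZr).

Lemma H3_timeE p : H3 p -> p 0 1 ^+ 2 + p 0 2 ^+ 2 + p 0 3 ^+ 2 = p 0 0 ^+ 2 - 1.
Proof. by case; rewrite lorE => pp _; lra. Qed.

(** By Lagrange's identity the gap is a sum of three squares. *)
Lemma cauchy3 (x y z x' y' z' : R) :
  (x * x' + y * y' + z * z') ^+ 2 <=
  (x ^+ 2 + y ^+ 2 + z ^+ 2) * (x' ^+ 2 + y' ^+ 2 + z' ^+ 2).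
Proof.
rewrite -subr_ge0.
have -> : (x ^+ 2 + y ^+ 2 + z ^+ 2) * (x' ^+ 2 + y' ^+ 2 + z' ^+ 2) -
  (x * x' + y * y' + z * z') ^+ 2 =
  (x * y' - y * x') ^+ 2 + (x * z' - z * x') ^+ 2 + (y * z' - z * y') ^+ 2.
  by ring.
by rewrite !addr_ge0 ?sqr_ge0.
Qed.

(** Tangency makes p0 v0 the spatial product of [p] and [v], so Cauchy-Schwarz bounds p0^2 v0^2 by
    (p0^2 - 1) S, where S is the squared spatial norm of [v]. Hence p0^2 times [lor v v] is at least
    S, and S = 0 would force v0 = 0 too. *)
Lemma lor_tangent_gt0 p v : H3 p -> tangent p v -> v != 0 -> 0 < lor v v.
Proof.
move=> Hp; have := H3_timeE p Hp; case: Hp => _ p0 pE.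
rewrite /tangent !lorE => pv v0.
have := cauchy3 (p 0 1) (p 0 2) (p 0 3) (v 0 1) (v 0 2) (v 0 3).
rewrite pE; set S := v 0 1 ^+ 2 + _ + _ => cs.
have {}cs : p 0 0 ^+ 2 * v 0 0 ^+ 2 <= (p 0 0 ^+ 2 - 1) * S.
  apply: le_trans cs; rewrite -exprMn le_eqVlt; apply/orP; left.
  by apply/eqP; congr (_ ^+ 2); lra.
have S0 : 0 < S.
  rewrite lt_neqAle eq_sym; apply/andP; split; last by rewrite !addr_ge0 ?sqr_ge0.
  apply: contra v0; rewrite !paddr_eq0 ?addr_ge0 ?sqr_ge0// !sqrf_eq0.
  move=> /andP[/andP[/eqP v1 /eqP v2] /eqP v3].
  have v00 : v 0 0 = 0.
    move: pv; rewrite v1 v2 v3 !mulr0 !addr0 => /eqP.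
    by rewrite oppr_eq0 mulf_eq0 gt_eqF//= => /eqP.
  apply/eqP/rowP => -[[|[|[|[|//]]]] i]; rewrite mxE;
    [rewrite -[RHS]v00|rewrite -[RHS]v1|rewrite -[RHS]v2|rewrite -[RHS]v3];
    by congr (v 0 _); apply: val_inj.
rewrite -(@pmulr_rgt0 _ (p 0 0 ^+ 2)) ?exprn_gt0//.
apply: (lt_le_trans S0).
have -> : p 0 0 ^+ 2 * (- (v 0 0 * v 0 0) +
    (v 0 1 * v 0 1 + v 0 2 * v 0 2 + v 0 3 * v 0 3)) =
  p 0 0 ^+ 2 * S - p 0 0 ^+ 2 * v 0 0 ^+ 2 by rewrite /S; ring.
lra.
Qed.

Lemma lor_tangent_ge0 p v : H3 p -> tangent p v -> 0 <= lor v v.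
Proof.
move=> Hp pv; have [->|/(lor_tangent_gt0 p v Hp pv)/ltW//] := eqVneq v 0.
by rewrite lor0l.
Qed.

Lemma lor_tangent_eq0 p v : H3 p -> tangent p v -> lor v v = 0 -> v = 0.
Proof.
move=> Hp pv vv; apply/eqP; apply: contraTT isT => v0.
by have := lor_tangent_gt0 p v Hp pv v0; rewrite vv ltxx.
Qed.

(** By Cauchy-Schwarz the spatial product of [p] and [q] stays below p0 q0. *)
Lemma H3_lor_lt0 p q : H3 p -> H3 q -> lor p q < 0.
Proof.
move=> Hp Hq; have pE := H3_timeE p Hp; have qE := H3_timeE q Hq.
case: Hp Hq => _ p0 [_ q0].
have := cauchy3 (p 0 1) (p 0 2) (p 0 3) (q 0 1) (q 0 2) (q 0 3).
rewrite pE qE lorE; set S := (_ + _ + _) => cs.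
have p1 : 1 <= p 0 0 ^+ 2 by rewrite -subr_ge0 -pE !addr_ge0 ?sqr_ge0.
have q1 : 1 <= q 0 0 ^+ 2 by rewrite -subr_ge0 -qE !addr_ge0 ?sqr_ge0.
have : S ^+ 2 < (p 0 0 * q 0 0) ^+ 2 by rewrite exprMn; nra.
have pq0 : 0 < p 0 0 * q 0 0 by rewrite mulr_gt0.
have [S0|S0 _] := leP 0 S; last lra.
by rewrite ltr_pXn2r ?nnegrE// ?ltW//; lra.
Qed.

(** This bound keeps hyperbolic arcs on the upper sheet. *)
Lemma H3_tangent_time p u : H3 p -> tangent p u -> lor u u = 1 ->
  `|u 0 0| < p 0 0.
Proof.
move=> Hp; have pE := H3_timeE p Hp; case: Hp => _ p0.
rewrite /tangent !lorE => pu uu.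
have := cauchy3 (p 0 1) (p 0 2) (p 0 3) (u 0 1) (u 0 2) (u 0 3).
rewrite pE.
have -> : p 0 1 * u 0 1 + p 0 2 * u 0 2 + p 0 3 * u 0 3 = p 0 0 * u 0 0 by lra.
have -> : u 0 1 ^+ 2 + u 0 2 ^+ 2 + u 0 3 ^+ 2 = 1 + u 0 0 ^+ 2 by lra.
rewrite exprMn => cs.
by rewrite -(@ltr_pXn2r _ 2) ?nnegrE ?(ltW p0)// real_normK ?num_real//; lra.
Qed.

End Minkowski.

(** * Hyperbolic functions and the linear equation f'' = r^2 f *)

Section Hyperbolic_functions.
Context {R : realType}.
Implicit Types x : R.

Definition cosh x : R := (expR x + expR (- x)) / 2.
Definition sinh x : R := (expR x - expR (- x)) / 2.

Lemma cosh0 : cosh 0 = 1.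
Proof. by rewrite /cosh oppr0 expR0; field. Qed.

Lemma sinh0 : sinh 0 = 0.
Proof. by rewrite /sinh oppr0 expR0; field. Qed.

Lemma cosh2Bsinh2 x : cosh x ^+ 2 - sinh x ^+ 2 = 1.
Proof. by rewrite -(expRxMexpNx_1 x) /cosh /sinh; field. Qed.

Lemma sinh_neq0 x : x != 0 -> sinh x != 0.
Proof.
apply: contra; rewrite mulf_eq0 invr_eq0 pnatr_eq0 orbF subr_eq0.
by move=> /eqP/expR_inj/eqP; rewrite -subr_eq0 opprK -mulr2n mulrn_eq0.
Qed.

(** Since (a + m)(a - m) = 1 and a > 0, both factors are positive; x = ln (a + m) makes them the
    exponentials of x and -x. *)
Lemma exists_cosh_sinh (a m : R) : a ^+ 2 - m ^+ 2 = 1 -> 0 < a ->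
  exists x, cosh x = a /\ sinh x = m.
Proof.
move=> am a0.
have h : (a + m) * (a - m) = 1 by rewrite -am; ring.
have am0 : 0 < a + m.
  by rewrite ltNge; apply/negP => am0; nra.
exists (ln (a + m)).
have e1 : expR (ln (a + m)) = a + m by rewrite lnK.
have e2 : expR (- ln (a + m)) = a - m.
  by rewrite expRN e1; apply: (mulfI (lt0r_neq0 am0)); rewrite h divff// lt0r_neq0.
by rewrite /cosh /sinh e1 e2; split; field.
Qed.

Lemma is_derive_expRM (r t : R) :
  is_derive t 1 (fun t => expR (r * t)) (r * expR (r * t)).
Proof.
have rid : is_derive t 1 (r \*: (@id R)) (r *: 1) by exact: is_deriveZ.
have := @is_derive1_comp _ expR (r \*: id) t _ _ (is_derive_expR _) rid.
move=> h; apply: is_derive_eq h _.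
by rewrite /= scaler1 mulrC.
Qed.

Lemma is_derive_cosh (r t : R) :
  is_derive t 1 (fun t => cosh (r * t)) (r * sinh (r * t)).
Proof.
have -> : (fun t => cosh (r * t)) =
  2^-1 \*: ((fun t => expR (r * t)) + (fun t => expR (- r * t))).
  by apply/funext => x; rewrite /cosh mulrC -mulNr.
have ? := is_derive_expRM r t; have ? := is_derive_expRM (- r) t.
apply: is_derive_eq.
by rewrite /sinh /GRing.scale/= !mulNr; field.
Qed.

Lemma is_derive_sinh (r t : R) :
  is_derive t 1 (fun t => sinh (r * t)) (r * cosh (r * t)).
Proof.
have -> : (fun t => sinh (r * t)) =
  2^-1 \*: ((fun t => expR (r * t)) - (fun t => expR (- r * t))).
  by apply/funext => x; rewrite /sinh mulrC -mulNr.
have ? := is_derive_expRM r t; have ? := is_derive_expRM (- r) t.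
apply: is_derive_eq.
by rewrite /cosh /GRing.scale/= !mulNr; field.
Qed.

(** The operator D^2 - r^2 factors as (D + r)(D - r). The integrating factors exp(r t) and exp(-r t)
    remove one factor each, including when r = 0. *)
Lemma linear_ode_eq0 (r : R) (f df : R -> R) :
  (forall t : R, is_derive t 1 f (df t)) ->
  (forall t : R, is_derive t 1 df (r ^+ 2 * f t)) ->
  f 0 = 0 -> df 0 = 0 -> forall t, f t = 0.
Proof.
move=> fE dfE f0 df0.
have first_order t : df t - r * f t = 0.
  pose g x := expR (r * x) * (df x - r * f x).
  have : g t = g 0.
    apply: is_derive_0_is_cst => x.
    rewrite (_ : g = (fun x => expR (r * x)) * (df - r \*: f)) //.
    have ? := is_derive_expRM r x; have ? := fE x; have ? := dfE x.
    apply: is_derive_eq; rewrite /GRing.scale/= !fctE/=.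
    by rewrite /GRing.scale/=; ring.
  rewrite /g f0 df0 mulr0 subrr mulr0 => /eqP.
  by rewrite mulf_eq0 gt_eqF ?expR_gt0//= => /eqP.
move=> t.
pose g x := expR (- r * x) * f x.
have : g t = g 0.
  apply: is_derive_0_is_cst => x.
  rewrite (_ : g = (fun x => expR (- r * x)) * f) //.
  have ? := is_derive_expRM (- r) x; have ? := fE x.
  apply: is_derive_eq; rewrite /GRing.scale/=.
  by have /eqP := first_order x; rewrite subr_eq0 => /eqP ->; ring.
rewrite /g f0 mulr0 => /eqP.
by rewrite mulf_eq0 gt_eqF ?expR_gt0//= => /eqP.
Qed.

End Hyperbolic_functions.

(** * Explicit geodesics of the hyperboloid and their uniqueness *)

Section Curves.
Context {R : realType}.
Implicit Types (c d : R -> 'rV[R]_4) (p q u v w : 'rV[R]_4) (a r t : R).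

Lemma is_derive_rVP n (c : R -> 'rV[R]_n) t (v : 'rV[R]_n) :
  is_derive t 1 c v <-> forall i, is_derive t 1 (fun x => c x 0 i) (v 0 i).
Proof.
split=> [[dc cE] i|H].
  apply: DeriveDef; first by move/derivable_mxP : dc; exact.
  by rewrite -cE derive_mx// mxE.
have dc : derivable c t 1.
  by apply/derivable_mxP => i j; rewrite ord1; exact: ex_derive.
apply: DeriveDef => //; rewrite derive_mx//; apply/rowP => i.
by rewrite mxE; exact: derive_val.
Qed.

Lemma is_derive_derive1 c t v : is_derive t 1 c v -> derive1 c t = v.
Proof. by move=> h; rewrite derive1E; exact: derive_val. Qed.

Lemma derivable_is_derive1 c t : derivable c t 1 -> is_derive t 1 c (derive1 c t).
Proof. by rewrite derive1E => /derivableP. Qed.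

Lemma is_derive_lor c d t v w : is_derive t 1 c v -> is_derive t 1 d w ->
  is_derive t 1 (fun x => lor (c x) (d x)) (lor v (d t) + lor (c t) w).
Proof.
move=> /is_derive_rVP cE /is_derive_rVP dE.
have -> : (fun x => lor (c x) (d x)) = - ((fun x => c x 0 0) * (fun x => d x 0 0)) +
  ((fun x => c x 0 1) * (fun x => d x 0 1) + (fun x => c x 0 2) * (fun x => d x 0 2) +
   (fun x => c x 0 3) * (fun x => d x 0 3)).
  by apply/funext => x; rewrite lorE.
apply: is_derive_eq.
by rewrite !lorE /GRing.scale/=; ring.
Qed.

Lemma is_derive_lcomb c d t v w a b : is_derive t 1 c v -> is_derive t 1 d w ->
  is_derive t 1 (fun x => a *: c x + b *: d x) (a *: v + b *: w).
Proof.
move=> cE dE.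
exact: (@is_deriveD _ _ _ (a \*: c) (b \*: d)).
Qed.

(* For a tangent vector [u] at [p] of norm 1, or for [r = 0], this is the geodesic
   through [p] with velocity [r *: u]. *)
Definition hyp_arc r p u t : 'rV[R]_4 := cosh (r * t) *: p + sinh (r * t) *: u.

Lemma is_derive_hyp_arc r p u t :
  is_derive t 1 (hyp_arc r p u) (hyp_arc r (r *: u) (r *: p) t).
Proof.
apply/is_derive_rVP => i.
have -> : (fun x => hyp_arc r p u x 0 i) =
    p 0 i \*: (fun x => cosh (r * x)) + u 0 i \*: (fun x => sinh (r * x)).
  by apply/funext => x; rewrite !mxE mulrC; congr (_ + _); rewrite mulrC.
have ? := is_derive_cosh r t; have ? := is_derive_sinh r t.
apply: is_derive_eq; rewrite !mxE /GRing.scale/=; ring.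
Qed.

Lemma derive1_hyp_arc r p u :
  derive1 (hyp_arc r p u) = hyp_arc r (r *: u) (r *: p).
Proof.
by apply/funext => t; apply: is_derive_derive1; exact: is_derive_hyp_arc.
Qed.

Lemma smooth_hyp_arc r p u : smooth_on setT (hyp_arc r p u).
Proof.
move=> n t _.
(* Differentiation stays in the family of arcs with the same [r] and changes only the two
   vectors. *)
suff [p' [u' ->]] : exists p' u', derive1n n (hyp_arc r p u) = hyp_arc r p' u'.
  exact/ex_derive/is_derive_hyp_arc.
elim: n => [|n [p' [u' IH]]]; first by exists p, u.
by exists (r *: u'), (r *: p'); rewrite derive1nS IH derive1_hyp_arc.
Qed.

Lemma hyp_arc0 r p u : hyp_arc r p u 0 = p.
Proof. by rewrite /hyp_arc mulr0 cosh0 sinh0 scale1r scale0r addr0. Qed.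

Lemma H3_hyp_arc r p u t : H3 p -> tangent p u -> lor u u = 1 ->
  H3 (hyp_arc r p u t).
Proof.
move=> Hp pu uu; have := H3_tangent_time p u Hp pu uu; rewrite ltr_norml.
case: (Hp) => pp p0 /andP[u1 u2]; split.
  rewrite /hyp_arc !lor_lin pp uu (lorC u p) pu.
  have := cosh2Bsinh2 (r * t); lra.
rewrite !mxE /cosh /sinh.
(* Regrouped by exponentials, the time coordinate has coefficients p0 + u0 and p0 - u0, both
   positive. *)
have -> : (expR (r * t) + expR (- (r * t))) / 2 * p 0 0 +
  (expR (r * t) - expR (- (r * t))) / 2 * u 0 0 =
  (expR (r * t) * (p 0 0 + u 0 0) + expR (- (r * t)) * (p 0 0 - u 0 0)) / 2.
  by field.
by rewrite divr_gt0// addr_gt0// mulr_gt0 ?expR_gt0//; lra.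
Qed.

(** The acceleration is r^2 times the position, so the tangential projection kills it. The case
    [r = 0] is the constant geodesic. *)
Lemma is_geodesic_hyp_arc r p u : H3 p -> tangent p u ->
  r = 0 \/ lor u u = 1 -> is_geodesic (hyp_arc r p u).
Proof.
move=> Hp pu ru.
split; first exact: smooth_hyp_arc.
  move=> t; case: ru => [->|]; last exact: H3_hyp_arc.
  by rewrite /hyp_arc !mul0r cosh0 sinh0 scale1r scale0r addr0.
move=> t; rewrite /cov_deriv /tan_proj !derive1_hyp_arc.
have -> : hyp_arc r (r *: (r *: p)) (r *: (r *: u)) t = r ^+ 2 *: hyp_arc r p u t.
  by rewrite /hyp_arc; apply/rowP => i; rewrite !mxE; ring.
rewrite lorZr; case: ru => [->|uu]; first by rewrite expr0n !(mul0r, scale0r) addr0.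
have [-> _] := H3_hyp_arc r p u t Hp pu uu.
by rewrite mulrN1 scaleNr subrr.
Qed.

(** Differentiating [lor c c = -1] twice turns the geodesic equation into c'' = lor c' c' c. The
    speed is then constant, so each coordinate of the difference between [c] and the arc solves f''
    = r^2 f with zero initial data. *)
Lemma geodesic_unique c r : is_geodesic c ->
  lor (derive1 c 0) (derive1 c 0) = r ^+ 2 ->
  c = hyp_arc r (c 0) (r^-1 *: derive1 c 0).
Proof.
move=> [sc Hc geo] r2.
have dc t : is_derive t 1 c (derive1 c t) by exact/derivable_is_derive1/(sc 0%N).
have ddc t : is_derive t 1 (derive1 c) (derive1 (derive1 c) t).
  exact/derivable_is_derive1/(sc 1%N).
have cc : (fun t => lor (c t) (c t)) = cst (- 1).
  by apply/funext => t; case: (Hc t).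
have cdc t : lor (c t) (derive1 c t) = 0.
  have := is_derive_lor _ _ _ _ _ (dc t) (dc t); rewrite cc => -[_].
  rewrite derive_cst (lorC _ (c t)) => /esym/eqP.
  by rewrite -mulr2n mulrn_eq0 => /eqP.
have cddc t : lor (c t) (derive1 (derive1 c) t) = - lor (derive1 c t) (derive1 c t).
  have := is_derive_lor _ _ _ _ _ (dc t) (ddc t).
  rewrite (_ : (fun t => lor (c t) (derive1 c t)) = cst 0); last exact/funext.
  case=> _; rewrite derive_cst => /esym/eqP.
  by rewrite addrC addr_eq0 => /eqP.
have ddcE t : derive1 (derive1 c) t = lor (derive1 c t) (derive1 c t) *: c t.
  have /eqP := geo t; rewrite /cov_deriv /tan_proj cddc scaleNr subr_eq0.
  by move=> /eqP.
have speed t : lor (derive1 c t) (derive1 c t) = r ^+ 2.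
  pose speed2 x := lor (derive1 c x) (derive1 c x).
  rewrite -r2; apply: (is_derive_0_is_cst (f := speed2)) => x.
  apply: is_derive_eq (is_derive_lor _ _ _ _ _ (ddc x) (ddc x)) _.
  by rewrite ddcE lorZl lorZr (lorC _ (c x)) cdc mulr0 addr0.
(* For [r = 0], where [r^-1] is 0, the initial velocity is tangent of norm zero, hence zero. *)
have rv : r *: (r^-1 *: derive1 c 0) = derive1 c 0.
  rewrite scalerA; have [r0|r0] := eqVneq r 0; last by rewrite divff// scale1r.
  apply/esym; rewrite (lor_tangent_eq0 (c 0) (derive1 c 0)) ?scaler0//.
  by rewrite r2 r0 expr0n.
set u := r^-1 *: _ in rv *.
apply/funext => t; apply/eqP; rewrite -subr_eq0.
apply/eqP/rowP => i; rewrite [RHS]mxE.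
pose w x := c x - hyp_arc r (c 0) u x.
pose dw x := derive1 c x - hyp_arc r (r *: u) (r *: c 0) x.
apply: (@linear_ode_eq0 _ r (fun x => w x 0 i) (fun x => dw x 0 i)).
- move=> x; move: i; apply/is_derive_rVP.
  apply: (@is_deriveB _ _ _ c (hyp_arc r (c 0) u)) => //.
  exact: is_derive_hyp_arc.
- move=> x.
  have -> : r ^+ 2 * w x 0 i = (r ^+ 2 *: w x) 0 i by rewrite !mxE.
  move: i; apply/is_derive_rVP.
  apply: is_derive_eq.
    apply: (@is_deriveB _ _ _ (derive1 c) (hyp_arc r (r *: u) (r *: c 0))) => //.
    exact: is_derive_hyp_arc.
  rewrite ddcE speed /w scalerBr; congr (_ - _).
  by rewrite /hyp_arc; apply/rowP => i; rewrite !mxE; ring.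
- by rewrite /w hyp_arc0 subrr mxE.
- by rewrite /dw hyp_arc0 rv subrr mxE.
Qed.

(** The arc shows that the set defining [geod] is inhabited; uniqueness then identifies the chosen
    element. Either square root [r] may be taken, so no sign has to be checked. *)
Lemma geodE r p v : H3 p -> tangent p v -> lor v v = r ^+ 2 ->
  geod p v = hyp_arc r p (r^-1 *: v).
Proof.
move=> Hp pv vv; rewrite /geod; set A := (X in get X).
have [c Ac] : exists c, A c.
  exists (hyp_arc r p (r^-1 *: v)); split; last 2 first.
  - by rewrite hyp_arc0.
  - rewrite derive1_hyp_arc hyp_arc0 scalerA.
    have [r0|r0] := eqVneq r 0; last by rewrite divff// scale1r.
    by rewrite r0 mul0r scale0r (lor_tangent_eq0 _ _ Hp pv)// vv r0 expr0n.
  - apply: is_geodesic_hyp_arc => //; first by rewrite /tangent lorZr pv mulr0.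
    have [|r0] := eqVneq r 0; [by left|right].
    by rewrite lorZl lorZr vv; field.
have [geo c0 dc0] : A (get A) by apply: getPex; exists c.
rewrite (geodesic_unique (get A) r) ?dc0// c0//.
Qed.

End Curves.

(** * Images under the exponential map, and the rank of two orthogonal rows *)

Section Planes.
Context {R : realType}.
Implicit Types (p q u v w : 'rV[R]_4) (a r t : R).

(** Geodesics from [p] stay in the span of [p] and their velocity. Conversely, a point a p + v of
    [H3] has a^2 - lor v v = 1 and a > 0, so a = cosh x and the norm of v is sinh x for some x. *)
Lemma image_hexp p (V : set 'rV[R]_4) : H3 p ->
  (forall v, V v -> tangent p v) -> (forall a v, V v -> V (a *: v)) ->
  hexp p @` V = [set q | H3 q /\ exists a, exists2 v, V v & q = a *: p + v].
Proof.
move=> Hp Vp Vscale; apply/seteqP; split=> q /=.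
  move=> [v Vv <-]; have pv := Vp v Vv.
  have /sqr_sqrtr/esym := lor_tangent_ge0 p v Hp pv.
  set r := Num.sqrt _ => vv.
  rewrite /hexp (geodE r)//; split; last first => /=.
    by exists (cosh (r * 1)); exists ((sinh (r * 1) / r) *: v);
      [exact: Vscale|rewrite -scalerA].
  have [||_ +_] := @is_geodesic_hyp_arc _ r p (r^-1 *: v) Hp; last exact.
    by rewrite /tangent lorZr pv mulr0.
  have [|r0] := eqVneq r 0; [by left|right].
  by rewrite lorZl lorZr vv; field.
move=> [Hq [a [v Vv qE]]]; have pv := Vp v Vv.
have [[pp _] [qq _]] := (Hp, Hq).
have vv : a ^+ 2 - lor v v = 1.
  by move: qq; rewrite qE !lor_lin pp (lorC v p) pv; lra.
(* Pairing [q] with [p] gives -a. *)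
have a0 : 0 < a.
  by have := H3_lor_lt0 p q Hp Hq; rewrite qE !lor_lin pp pv; lra.
have /sqr_sqrtr m2 := lor_tangent_ge0 p v Hp pv.
rewrite -m2 in vv; set m := Num.sqrt _ in m2 vv.
have [x [xa xm]] := exists_cosh_sinh a m vv a0.
(* Rescaling [v] from norm m to norm x gives the preimage; if m = 0 then v = 0 and q = p. *)
exists ((x / m) *: v); first exact: Vscale.
have [m0|m0] := eqVneq m 0.
  have v0 : v = 0 by apply: (lor_tangent_eq0 p) => //; rewrite -m2 m0 expr0n.
  have a1 : a = 1 by move: vv; rewrite m0 => ?; nra.
  rewrite qE v0 a1 scaler0 scale1r addr0 /hexp (geodE 0)//.
  - by rewrite /hyp_arc mul0r cosh0 sinh0 scale1r scale0r addr0.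
  - by rewrite /tangent -(scale0r 0) lorZr mul0r.
  - by rewrite lor0l expr0n.
have x0 : x != 0 by apply: contra_neq m0 => x0; rewrite -xm x0 sinh0.
rewrite /hexp (geodE x)//.
- rewrite /hyp_arc mulr1 xa xm qE !scalerA; congr (_ + _).
  by rewrite mulrA divfK// divff// scale1r.
- by rewrite /tangent lorZr pv mulr0.
- by rewrite lorZl lorZr -m2; field.
Qed.

Lemma sub_col_mxP n (x y v : 'rV[R]_n) :
  (v <= col_mx x y)%MS <-> exists a b, v = a *: x + b *: y.
Proof.
rewrite -addsmxE; split=> [/sub_addsmxP[[A B] ->]|[a [b ->]]].
  exists (A 0 0), (B 0 0).
  by rewrite (mx11_scalar A) (mx11_scalar B) !mul_scalar_mx !mxE.
by rewrite addmx_sub_adds// scalemx_sub.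
Qed.

(** Pairing a vanishing combination with [y] kills the coefficient of [y], which leaves a multiple
    of [x]. *)
Lemma row_free_col_mx_lor (x y : 'rV[R]_4) : lor x y = 0 -> lor y y = 1 ->
  row_free (col_mx x y) <-> x != 0.
Proof.
move=> xy yy; split=> [/row_free_inj inj|x0].
  apply/eqP => x0; have : row_mx 1 0 = 0 :> 'rV[R]_(1 + 1).
    by apply: inj; rewrite mul_row_col mul1mx !mul0mx x0 addr0.
  move/rowP/(_ 0); rewrite !mxE; case: split_ordP => // j _.
  by rewrite ord1 mxE => /eqP; rewrite oner_eq0.
apply: inj_row_free => v; rewrite -(hsubmxK v) mul_row_col.
rewrite (mx11_scalar (lsubmx v)) (mx11_scalar (rsubmx v)) !mul_scalar_mx.
set a := lsubmx v 0 0; set b := rsubmx v 0 0 => ab.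
have b0 : b = 0.
  by have := lor0l y; rewrite -ab !lor_lin xy yy mulr0 add0r mulr1.
have /eqP : a *: x = 0 by move: ab; rewrite b0 scale0r addr0.
rewrite scaler_eq0 (negbTE x0) orbF => /eqP a0.
by rewrite a0 b0 !raddf0 row_mx0.
Qed.

End Planes.

(** * Tangent planes of the ruled surface and developability *)

Section Ruled_surface.
Context {R : realType}.
Variables (I : set R) (alpha N : R -> 'rV[R]_4).
Hypotheses (openI : open I) (halpha : immersed_curve I alpha)
  (hN : unit_normal_field I alpha N).
Local Notation f := (ruled_surface alpha N).
Local Notation alpha' := (derive1 alpha).
Local Notation N' := (derive1 N).

Lemma is_derive_alpha s : I s -> is_derive s 1 alpha (alpha' s).
Proof. by case: halpha => /(_ 0%N) sm _ _ /sm; exact: derivable_is_derive1. Qed.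

Lemma is_derive_N s : I s -> is_derive s 1 N (N' s).
Proof. by case: hN => /(_ 0%N) sm _ /sm; exact: derivable_is_derive1. Qed.

(** The relations hold only on [I]; openness of [I] makes [g] constant near [s]. *)
Lemma derive_const_on (g : R -> R) s k d : I s -> (forall x, I x -> g x = k) ->
  is_derive s 1 g d -> d = 0.
Proof.
move=> Is gk [_ <-]; rewrite (@near_eq_derive _ _ _ g (cst k)) ?derive_cst//.
by near=> x; apply: gk; near: x; exact: open_nbhs_nbhs.
Unshelve. all: by end_near. Qed.

Lemma lor_alpha_alpha' s : I s -> lor (alpha s) (alpha' s) = 0.
Proof.
move=> Is; have da := is_derive_alpha s Is.
have aa x : I x -> lor (alpha x) (alpha x) = -1.
  by case: halpha => _ + _ => /[apply] -[].
have /eqP := derive_const_on _ s _ _ Is aa (is_derive_lor _ _ _ _ _ da da).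
by rewrite (lorC (alpha' s)) -mulr2n mulrn_eq0 => /eqP.
Qed.

Lemma lor_N_N' s : I s -> lor (N s) (N' s) = 0.
Proof.
move=> Is; have dN := is_derive_N s Is.
have NN x : I x -> lor (N x) (N x) = 1 by case: hN => _ /[apply] -[].
have /eqP := derive_const_on _ s _ _ Is NN (is_derive_lor _ _ _ _ _ dN dN).
by rewrite (lorC (N' s)) -mulr2n mulrn_eq0 => /eqP.
Qed.

Lemma lor_alpha_N' s : I s -> lor (alpha s) (N' s) = 0.
Proof.
move=> Is; have da := is_derive_alpha s Is; have dN := is_derive_N s Is.
have aN x : I x -> lor (alpha x) (N x) = 0 by case: hN => _ /[apply] -[].
have := derive_const_on _ s _ _ Is aN (is_derive_lor _ _ _ _ _ da dN).
by case: hN => _ /(_ s Is)[_ Na' _]; rewrite (lorC (alpha' s)) Na' add0r.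
Qed.

(** As N' is orthogonal to alpha, the covariant derivative of N is N' itself. Its normal part is N'
    minus its projection to alpha', whose squared norm is positive. *)
Lemma RM_fieldP :
  RM_field I alpha N <-> forall s, I s -> exists k, N' s = k *: alpha' s.
Proof.
split=> H s Is; have := H s Is;
  rewrite /normal_deriv /cov_deriv /tan_proj lor_alpha_N'// scale0r addr0.
  by move/eqP; rewrite subr_eq0 => /eqP NE; eexists; exact: NE.
move=> [k ->]; rewrite lorZl mulfK ?subrr//.
apply/lt0r_neq0/(lor_tangent_gt0 (alpha s)); last by case: halpha => _ _; apply.
  by case: halpha => _ + _; apply.
exact: lor_alpha_alpha'.
Qed.

Lemma ruled_surfaceE s : I s -> f s = hyp_arc 1 (alpha s) (N s).
Proof.
move=> Is; case: halpha => _ /(_ s Is) Ha _; case: hN => _ /(_ s Is)[aN _ NN].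
rewrite /ruled_surface; apply/funext => l.
by rewrite (geodE 1) ?invr1 ?scale1r ?expr1n.
Qed.

(** [X] and [Y] are the partial derivatives of the surface across and along the ruling. *)
Let X s l := cosh l *: alpha' s + sinh l *: N' s.
Let Y s l := sinh l *: alpha s + cosh l *: N s.

Lemma partials_ruled s l : I s -> partials f s l = col_mx (X s l) (Y s l).
Proof.
move=> Is; congr col_mx; last first.
  by rewrite ruled_surfaceE// derive1_hyp_arc /hyp_arc !mul1r !scale1r addrC.
apply: is_derive_derive1.
have da := is_derive_alpha s Is; have dN := is_derive_N s Is.
(* The explicit formula for the surface is known only for parameters in [I], which suffices near
   [s]. *)
apply: near_eq_is_derive (is_derive_lcomb _ _ _ _ _ _ _ da dN).
near=> x; rewrite ruled_surfaceE ?/hyp_arc ?mul1r//.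
by near: x; exact: open_nbhs_nbhs.
Unshelve. all: by end_near. Qed.

(** Pairing with alpha and N therefore reads off the coordinates of a vector in the span of alpha, N
    and [X]. *)
Lemma lor_frame s l : I s ->
  [/\ lor (alpha s) (alpha s) = -1, lor (alpha s) (N s) = 0,
      lor (N s) (N s) = 1, lor (alpha s) (X s l) = 0 & lor (N s) (X s l) = 0].
Proof.
move=> Is; case: halpha => _ /(_ s Is)[aa _] _; case: hN => _ /(_ s Is)[aN Na' NN].
split=> //; rewrite /X !lor_lin ?lor_alpha_alpha' ?lor_alpha_N' ?Na' ?lor_N_N'//;
  by rewrite !mulr0 addr0.
Qed.

Lemma regular_ruledP s l : I s -> regular_at f s l <-> X s l != 0.
Proof.
move=> Is; rewrite /regular_at partials_ruled//.
have [aa aN NN aX NX] := lor_frame s l Is.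
apply: row_free_col_mx_lor.
  move: (X s l) aX NX => x aX NX.
  by rewrite /Y !lor_lin (lorC _ (alpha s)) (lorC _ (N s)) aX NX !mulr0 addr0.
rewrite /Y !lor_lin (lorC (N s) (alpha s)) aa aN NN; have := cosh2Bsinh2 l; lra.
Qed.

(** The surface point and [Y] arise from alpha and N by a hyperbolic rotation of angle l, so both
    pairs span the same plane and only [X] depends on l. *)
Lemma tangent_plane_ruled s l : I s ->
  tangent_plane f s l =
  [set q | H3 q /\ exists x y z, q = x *: alpha s + y *: N s + z *: X s l].
Proof.
move=> Is; rewrite /tangent_plane /tangent_space partials_ruled// ruled_surfaceE//.
have [aa aN NN aX NX] := lor_frame s l Is.
have Ha : H3 (alpha s) by case: halpha => _ + _; apply.
rewrite image_hexp.
- apply/seteqP; split=> q /= -[Hq].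
  + move=> [a [v /sub_col_mxP[z [b ->]] qE]]; split=> //.
    exists (a * cosh l + b * sinh l), (a * sinh l + b * cosh l), z.
    by rewrite qE /hyp_arc mul1r /Y; apply/rowP => i; rewrite !mxE; ring.
  + move=> [x [y [z qE]]]; split=> //.
    (* The coefficients come from the inverse rotation. *)
    exists (x * cosh l - y * sinh l).
    exists (z *: X s l + (y * cosh l - x * sinh l) *: Y s l).
      by apply/sub_col_mxP; eexists; eexists.
    rewrite /hyp_arc mul1r /Y.
    have E : x *: alpha s + y *: N s =
      ((cosh l ^+ 2 - sinh l ^+ 2) * x) *: alpha s +
      ((cosh l ^+ 2 - sinh l ^+ 2) * y) *: N s by rewrite cosh2Bsinh2 !mul1r.
    by rewrite qE E; apply/rowP => i; rewrite !mxE; ring.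
- exact: H3_hyp_arc.
- move=> v /sub_col_mxP[z [b ->]]; rewrite /tangent /hyp_arc /Y mul1r.
  move: (X s l) aX NX => x aX NX; rewrite !lor_lin.
  by rewrite aX NX aa aN NN (lorC (N s)) aN; ring.
- by move=> a v vV; exact: scalemx_sub.
Qed.

Lemma developable_ruledP :
  developable I f <-> forall s, I s -> exists k, N' s = k *: alpha' s.
Proof.
split=> [dev s Is|prop s Is].
  have a'0 : alpha' s != 0 by case: halpha => _ _; apply.
  have Ha : H3 (alpha s) by case: halpha => _ + _; apply.
  (* As sinh 1 is nonzero, such a relation can be solved for N'. *)
  suff [b [c c0 bcE]] : exists b, exists2 c, c != 0 & b *: alpha' s = c *: X s 1.
    have s0 : sinh 1 != 0 :> R by rewrite sinh_neq0.
    exists ((b - c * cosh 1) / (c * sinh 1)).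
    apply: (@scalerI _ _ (c * sinh 1)); first by rewrite mulf_neq0.
    rewrite scalerA [in RHS]mulrC divfK ?mulf_neq0//.
    by rewrite scalerBl bcE /X scalerDr !scalerA addrC addKr.
  (* If the surface is singular at l = 1, the relation is immediate; otherwise the planes at 0 and 1
     can be compared. *)
  have [X0|X0] := eqVneq (X s 1) 0.
    by exists 0, 1; rewrite ?oner_neq0// X0 scale0r scaler0.
  have [aa aN NN aX NX] := lor_frame s 1 Is.
  have aa' := lor_alpha_alpha' s Is.
  have a'a'0 : 0 < lor (alpha' s) (alpha' s) by exact: (lor_tangent_gt0 (alpha s)).
  have m2 := sqr_sqrtr (ltW a'a'0); set m := Num.sqrt _ in m2.
  have m0 : m != 0 by rewrite -sqrf_eq0 m2 lt0r_neq0.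
  (* This puts the test point at distance 1 from alpha on the geodesic in direction alpha', hence in
     the plane at l = 0. *)
  pose b := sinh 1 / m.
  have b0 : b != 0 by rewrite mulf_neq0 ?invr_eq0// sinh_neq0.
  have Hq : H3 (cosh 1 *: alpha s + b *: alpha' s).
    have : H3 (hyp_arc 1 (alpha s) (m^-1 *: alpha' s) 1).
      apply: H3_hyp_arc => //; first by rewrite /tangent lorZr aa' mulr0.
      by rewrite lorZl lorZr -m2; field.
    by rewrite /hyp_arc mulr1 scalerA.
  have r0 : regular_at f s 0.
    by rewrite regular_ruledP// /X cosh0 sinh0 scale1r scale0r addr0.
  have r1 : regular_at f s 1 by rewrite regular_ruledP.
  have := dev s Is 0 1 r0 r1; rewrite !tangent_plane_ruled//.
  move=> /seteqP[/(_ (cosh 1 *: alpha s + b *: alpha' s)) + _] => /= -[].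
    split=> //; exists (cosh 1), 0, b.
    by rewrite /X cosh0 sinh0 !scale0r scale1r !addr0.
  move=> _ [x [y [z qE]]].
  have Na' : lor (N s) (alpha' s) = 0 by case: hN => _ /(_ s Is)[].
  (* Pairing with alpha, then with N, leaves only the components along alpha' and [X s 1]. *)
  have xE : x = cosh 1.
    move: aX (congr1 (lor (alpha s)) qE); move: (X s 1) => w aX.
    rewrite !lor_lin aa aa' aN aX.
    by rewrite !mulr0 !addr0 !mulrN1 => /oppr_inj.
  have y0 : y = 0.
    move: NX (congr1 (lor (N s)) qE); move: (X s 1) => w NX.
    rewrite !lor_lin (lorC (N s) (alpha s)) aN NN Na' NX.
    by rewrite !mulr0 mulr1 !add0r addr0.
  have bzE : b *: alpha' s = z *: X s 1.
    by move: qE; rewrite xE y0 scale0r addr0 => /addrI.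
  exists b, z => //; apply/negP => /eqP z0.
  by move/eqP: bzE; rewrite z0 scale0r scaler_eq0 (negbTE b0) (negbTE a'0).
move=> l1 l2.
have [k NE] := prop s Is.
have planeE l : regular_at f s l -> tangent_plane f s l =
    [set q | H3 q /\ exists x y z, q = x *: alpha s + y *: N s + z *: alpha' s].
  (* Regularity at l says exactly that this factor is nonzero, so [X s l] and alpha' span the same
     line. *)
  have XE : X s l = (cosh l + k * sinh l) *: alpha' s.
    by rewrite /X NE scalerA mulrC -scalerDl.
  rewrite regular_ruledP// XE scaler_eq0 negb_or => /andP[c0 _].
  rewrite tangent_plane_ruled// XE; apply/seteqP; split=> q /= -[Hq [x [y [z qE]]]];
    split=> //; exists x, y; rewrite qE.
    by eexists; rewrite scalerA.
  by exists (z / (cosh l + k * sinh l)); rewrite scalerA divfK.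
by move=> r1 r2; rewrite !planeE.
Qed.

End Ruled_surface.

Theorem theorem8 (R : realType) (I : set R) (alpha N : R -> 'rV[R]_4)
    (openI : open I) (itvI : is_interval I)
    (halpha : immersed_curve I alpha)
    (hN : unit_normal_field I alpha N) :
  developable I (ruled_surface alpha N) <-> RM_field I alpha N.
Proof. by rewrite (developable_ruledP I)// (RM_fieldP I)//. Qed.
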